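(* Let $p$ be a propositional variable and let $\phi$ be a formula of $\mathbb L(\rightsquigarrow)$ in which $p$ occurs only semi-positively. Then $$\mathsf{iSL}_{\mathsf a}\vdash\phi[p:\top]\leftrightarrow\phi\big[p:\phi[p:\top]\big].$$ Moreover, $\phi[p:\top]$ is the maximal fixed point of $\phi$: for every formula $\alpha$ with $\mathsf{iSL}_{\mathsf a}\vdash\alpha\leftrightarrow\phi[p:\alpha]$, we have $\mathsf{iSL}_{\mathsf a}\vdash\alpha\to\phi[p:\top]$.
   Context: Formulas of $\mathbb L(\rightsquigarrow)$ are built from propositional variables, $\top,\bot$, and binary connectives $\wedge,\vee,\to,\rightsquigarrow$. Abbreviations: $(\phi\leftrightarrow\psi):=((\phi\to\psi)\wedge(\psi\to\phi))$ and $\Box\phi:=(\top\rightsquigarrow\phi)$. $\phi[p:\psi]$ denotes the result of substituting $\psi$ for $p$ in $\phi$. The variable $p$ occurs only semi-positively in $\phi$ if each of its occurrences in $\phi$ is either positive (as usual: it lies inside the antecedents of an even number of arrows) or in the scope of an occurrence of $\rightsquigarrow$. The system $\mathsf{HLC}^\sharp$ is axiomatised by all axioms and rules of intuitionistic propositional logic, the rule: from $\vdash\phi\to\psi$ infer $\vdash\phi\rightsquigarrow\psi$, and the axiom schemes $((\phi\rightsquigarrow\psi)\wedge(\psi\rightsquigarrow\chi))\to(\phi\rightsquigarrow\chi)$, $((\phi\rightsquigarrow\psi)\wedge(\phi\rightsquigarrow\chi))\to(\phi\rightsquigarrow(\psi\wedge\chi))$, $((\phi\rightsquigarrow\chi)\wedge(\psi\rightsquigarrow\chi))\to((\phi\vee\psi)\rightsquigarrow\chi)$.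 $\mathsf{iSL}_{\mathsf a}$ is $\mathsf{HLC}^\sharp$ plus the axiom scheme $(\Box\phi\to\phi)\to\phi$ (all rules applying to the extended system). *)

(* Defs.v *)
From mathcomp Require Import all_boot.

Set Implicit Arguments.
Unset Strict Implicit.
Unset Printing Implicit Defensive.

Definition var := nat.

Inductive formula : Type :=
| Var of var
| Top
| Bot
| And of formula & formula
| Or of formula & formula
| Imp of formula & formula
| SImp of formula & formula.

Declare Scope formula_scope.
Delimit Scope formula_scope with F.
Bind Scope formula_scope with formula.

Notation "⊤" := Top : formula_scope.
Notation "⊥" := Bot : formula_scope.
Infix "∧" := And (at level 40, left associativity) : formula_scope.
Infix "∨" := Or (at level 50, left associativity) : formula_scope.
Infix "⇒" := Imp (at level 60, right associativity) : formula_scope.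
Infix "⇝" := SImp (at level 60, right associativity) : formula_scope.

Definition Iff (A B : formula) : formula := ((A ⇒ B) ∧ (B ⇒ A))%F.
Infix "⇔" := Iff (at level 70, no associativity) : formula_scope.

Definition Box (A : formula) : formula := (⊤ ⇝ A)%F.
Notation "□ A" := (Box A) (at level 30, right associativity) : formula_scope.

Fixpoint subst (p : var) (C A : formula) : formula :=
  match A with
  | Var q => if q == p then C else Var q
  | Top => Top
  | Bot => Bot
  | And A1 A2 => And (subst p C A1) (subst p C A2)
  | Or A1 A2 => Or (subst p C A1) (subst p C A2)
  | Imp A1 A2 => Imp (subst p C A1) (subst p C A2)
  | SImp A1 A2 => SImp (subst p C A1) (subst p C A2)
  end.
Notation "A [ p := C ]" := (subst p C A)
  (at level 8, left associativity, format "A [ p  :=  C ]") : formula_scope.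

(* [occurs p A n s]: some occurrence of [p] in [A] lies inside the antecedents
   of exactly [n] arrows, and [s] tells whether it is in the scope of a [⇝].
   Both kinds of arrow are counted in [n]. *)
Inductive occurs (p : var) : formula -> nat -> bool -> Prop :=
| occ_var : occurs p (Var p) 0 false
| occ_andl A B n s : occurs p A n s -> occurs p (A ∧ B) n s
| occ_andr A B n s : occurs p B n s -> occurs p (A ∧ B) n s
| occ_orl A B n s : occurs p A n s -> occurs p (A ∨ B) n s
| occ_orr A B n s : occurs p B n s -> occurs p (A ∨ B) n s
| occ_impl A B n s : occurs p A n s -> occurs p (A ⇒ B) n.+1 s
| occ_impr A B n s : occurs p B n s -> occurs p (A ⇒ B) n s
| occ_simpl A B n s : occurs p A n s -> occurs p (A ⇝ B) n.+1 true
| occ_simpr A B n s : occurs p B n s -> occurs p (A ⇝ B) n true.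

Definition semi_positive (p : var) (A : formula) : Prop :=
  forall n s, occurs p A n s -> ~~ odd n \/ s = true.

(* Theorems of HLC♯ extended with the axioms [Ax]. *)
Inductive HLCs (Ax : formula -> Prop) : formula -> Prop :=
| ax_extra A : Ax A -> HLCs Ax A
| ax_K A B : HLCs Ax (A ⇒ B ⇒ A)
| ax_S A B C : HLCs Ax ((A ⇒ B ⇒ C) ⇒ (A ⇒ B) ⇒ A ⇒ C)
| ax_andI A B : HLCs Ax (A ⇒ B ⇒ A ∧ B)
| ax_andE1 A B : HLCs Ax (A ∧ B ⇒ A)
| ax_andE2 A B : HLCs Ax (A ∧ B ⇒ B)
| ax_orI1 A B : HLCs Ax (A ⇒ A ∨ B)
| ax_orI2 A B : HLCs Ax (B ⇒ A ∨ B)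
| ax_orE A B C : HLCs Ax ((A ⇒ C) ⇒ (B ⇒ C) ⇒ A ∨ B ⇒ C)
| ax_top : HLCs Ax ⊤
| ax_bot A : HLCs Ax (⊥ ⇒ A)
| ax_trans A B C : HLCs Ax ((A ⇝ B) ∧ (B ⇝ C) ⇒ (A ⇝ C))
| ax_conj A B C : HLCs Ax ((A ⇝ B) ∧ (A ⇝ C) ⇒ (A ⇝ B ∧ C))
| ax_disj A B C : HLCs Ax ((A ⇝ C) ∧ (B ⇝ C) ⇒ (A ∨ B ⇝ C))
| rule_mp A B : HLCs Ax (A ⇒ B) -> HLCs Ax A -> HLCs Ax B
| rule_arr A B : HLCs Ax (A ⇒ B) -> HLCs Ax (A ⇝ B).

Inductive strong_lob_axiom : formula -> Prop :=
| strong_lob A : strong_lob_axiom ((□ A ⇒ A) ⇒ A).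

Definition iSLa : formula -> Prop := HLCs strong_lob_axiom.

(* Main.v *)
Require Import Defs.
From mathcomp Require Import all_boot.

(** Strong Löb yields the completeness principle [A ⇒ □ A]; combined with the
    fact that [□ (A ⇒ B)] implies [A ⇝ B], it makes substitution a congruence
    inside the logic: under any hypothesis [H], if [A] and [B] are equivalent
    then so are [phi[p := A]] and [phi[p := B]] ([entails_subst]).  Below a [⇝]
    a boxed equivalence is enough, so when [p] is semi-positive in [phi] the
    formulas [□ (A ⇒ B)], [□ (B ⇒ A)] and [A ⇒ B] give
    [phi[p := A] ⇒ phi[p := B]] ([entails_subst_polarity]).

    Write [F X] for [phi[p := X]].  As soon as [X] is assumed, [X] is equivalent
    to [⊤], so the congruence exchanges [F X] and [F ⊤].  With [X := F ⊤] this
    gives [F ⊤ ⇒ F (F ⊤)]; with [X := alpha] a fixed point it gives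
    [alpha ⇒ F ⊤], which is maximality.  For [F (F ⊤) ⇒ F ⊤], strong Löb allows
    one to assume [□ (F ⊤)] besides [F (F ⊤)].  The box makes [F ⊤] and [⊤]
    equivalent below every [⇝], and [F ⊤ ⇒ ⊤] holds outright, so semi-positive
    monotonicity carries [F (F ⊤)] to [F ⊤]. *)

(** * Reasoning under a hypothesis *)

Definition entails (Ax : formula -> Prop) (H A : formula) : Prop :=
  HLCs Ax (H ⇒ A)%F.

Lemma entails_thm Ax H A : HLCs Ax A -> entails Ax H A.
Proof. by move=> dA; apply: rule_mp dA; apply: ax_K. Qed.

Lemma entails_mp Ax H A B :
  entails Ax H (A ⇒ B)%F -> entails Ax H A -> entails Ax H B.
Proof. by move=> dAB; apply: rule_mp; apply: rule_mp dAB; apply: ax_S. Qed.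

Lemma entails_refl Ax A : entails Ax A A.
Proof. by apply: (@entails_mp _ _ (A ⇒ A)%F); apply: ax_K. Qed.

Lemma entails_trans Ax H G A :
  entails Ax H G -> entails Ax G A -> entails Ax H A.
Proof. by move=> dG dA; apply: entails_mp dG; apply: entails_thm. Qed.

Lemma entails_and Ax H A B :
  entails Ax H A -> entails Ax H B -> entails Ax H (A ∧ B)%F.
Proof.
move=> dA; apply: entails_mp; apply: entails_mp dA.
by apply: entails_thm; apply: ax_andI.
Qed.

Lemma entails_imp Ax H A B :
  entails Ax (H ∧ A)%F B -> entails Ax H (A ⇒ B)%F.
Proof.
move=> dB; apply: entails_trans (ax_andI Ax H A) _.
by apply: rule_mp (ax_S _ _ _ _) _; apply: entails_thm.
Qed.

Lemma entails_weaken Ax H G A : entails Ax H A -> entails Ax (H ∧ G)%F A.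
Proof. exact: entails_trans (ax_andE1 _ _ _). Qed.

Lemma entails_last Ax H A : entails Ax (H ∧ A)%F A.
Proof. exact: ax_andE2. Qed.

(** * Monotonicity of the connectives under a hypothesis *)

Lemma entails_imp_trans Ax H A B C :
    entails Ax H (A ⇒ B)%F -> entails Ax H (B ⇒ C)%F ->
  entails Ax H (A ⇒ C)%F.
Proof.
move=> dAB dBC; apply: entails_imp.
apply: entails_mp (entails_weaken _ _ _ _ dBC) _.
exact: entails_mp (entails_weaken _ _ _ _ dAB) (entails_last _ _ _).
Qed.

Lemma entails_and_mono Ax H A A' B B' :
    entails Ax H (A ⇒ A')%F -> entails Ax H (B ⇒ B')%F ->
  entails Ax H (A ∧ B ⇒ A' ∧ B')%F.
Proof.
move=> dA dB; apply: entails_imp; apply: entails_and.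
- apply: entails_mp (entails_weaken _ _ _ _ dA) _.
  exact: entails_trans (entails_last _ _ _) (ax_andE1 _ _ _).
- apply: entails_mp (entails_weaken _ _ _ _ dB) _.
  exact: entails_trans (entails_last _ _ _) (ax_andE2 _ _ _).
Qed.

Lemma entails_or_mono Ax H A A' B B' :
    entails Ax H (A ⇒ A')%F -> entails Ax H (B ⇒ B')%F ->
  entails Ax H (A ∨ B ⇒ A' ∨ B')%F.
Proof.
move=> dA dB.
apply: (@entails_mp _ _ (B ⇒ A' ∨ B')%F).
  apply: (@entails_mp _ _ (A ⇒ A' ∨ B')%F).
    by apply: entails_thm; apply: ax_orE.
  by apply: entails_imp_trans dA _; apply: entails_thm; apply: ax_orI1.
by apply: entails_imp_trans dB _; apply: entails_thm; apply: ax_orI2.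
Qed.

Lemma entails_imp_mono Ax H A A' B B' :
    entails Ax H (A' ⇒ A)%F -> entails Ax H (B ⇒ B')%F ->
  entails Ax H ((A ⇒ B) ⇒ (A' ⇒ B'))%F.
Proof.
move=> dA dB; apply: entails_imp.
apply: entails_imp_trans (entails_weaken _ _ _ _ dA) _.
exact: entails_imp_trans (entails_last _ _ _) (entails_weaken _ _ _ _ dB).
Qed.

Lemma entails_simp_trans Ax H A B C :
    entails Ax H (A ⇝ B)%F -> entails Ax H (B ⇝ C)%F ->
  entails Ax H (A ⇝ C)%F.
Proof.
move=> dAB dBC.
exact: entails_trans (entails_and _ _ _ _ dAB dBC) (ax_trans _ _ _ _).
Qed.

Lemma entails_box_mono Ax H A B :
  entails Ax A B -> entails Ax H (□ A)%F -> entails Ax H (□ B)%F.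
Proof.
move=> dAB dA; apply: entails_simp_trans dA _.
by apply: entails_thm; apply: rule_arr.
Qed.

Lemma entails_box_and Ax H A B :
    entails Ax H (□ A)%F -> entails Ax H (□ B)%F ->
  entails Ax H (□ (A ∧ B))%F.
Proof.
move=> dA dB.
exact: entails_trans (entails_and _ _ _ _ dA dB) (ax_conj _ _ _ _).
Qed.

(** Since [A ⇝ ⊤] is provable, [□ (A ⇒ B)] gives [A ⇝ (A ⇒ B)]; pairing the
    target with [A ⇝ A] and applying modus ponens there yields [A ⇝ B]. *)
Lemma entails_box_simp Ax H A B :
  entails Ax H (□ (A ⇒ B))%F -> entails Ax H (A ⇝ B)%F.
Proof.
move=> dAB.
have dA_AB : entails Ax H (A ⇝ (A ⇒ B))%F.
  apply: entails_simp_trans dAB; apply: entails_thm; apply: rule_arr.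
  by apply: entails_thm; apply: ax_top.
have dAA : entails Ax H (A ⇝ A)%F.
  by apply: entails_thm; apply: rule_arr; apply: entails_refl.
have dA_both : entails Ax H (A ⇝ (A ⇒ B) ∧ A)%F.
  exact: entails_trans (entails_and _ _ _ _ dA_AB dAA) (ax_conj _ _ _ _).
apply: entails_simp_trans dA_both _; apply: entails_thm; apply: rule_arr.
exact: entails_mp (ax_andE1 _ _ _) (ax_andE2 _ _ _).
Qed.

Lemma entails_simp_mono Ax H A A' B B' :
    entails Ax H (□ (A' ⇒ A))%F -> entails Ax H (□ (B ⇒ B'))%F ->
  entails Ax H ((A ⇝ B) ⇒ (A' ⇝ B'))%F.
Proof.
move=> dA dB; apply: entails_imp.
have dA' := entails_weaken _ _ (A ⇝ B)%F _ (entails_box_simp _ _ _ _ dA).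
have dB' := entails_weaken _ _ (A ⇝ B)%F _ (entails_box_simp _ _ _ _ dB).
apply: entails_simp_trans dA' _.
exact: entails_simp_trans (entails_last _ _ _) dB'.
Qed.

(** * Consequences of strong Löb *)

Lemma entails_lob H A :
  entails strong_lob_axiom (H ∧ □ A)%F A -> entails strong_lob_axiom H A.
Proof.
move=> dA; apply: (@entails_mp _ _ (□ A ⇒ A)%F); last exact: entails_imp.
by apply: entails_thm; apply: ax_extra; apply: strong_lob.
Qed.

(** The completeness principle. Strong Löb is applied to [A ∧ □ A]: the box of
    this formula supplies [□ A], and [A] is already available. *)
Lemma entails_box H A :
  entails strong_lob_axiom H A -> entails strong_lob_axiom H (□ A)%F.
Proof.
move=> dA.
apply: entails_trans (ax_andE2 _ A _); apply: entails_lob; apply: entails_and.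
  exact: entails_weaken.
apply: (@entails_box_mono _ _ (A ∧ □ A)%F); first exact: ax_andE1.
exact: entails_last.
Qed.

(** * Replacing a variable by related formulas *)

(** The completeness principle boxes the implications obtained for the
    arguments of a [⇝], which is the form that its monotonicity requires. *)
Lemma entails_subst p phi H A B :
    entails strong_lob_axiom H (A ⇒ B)%F ->
    entails strong_lob_axiom H (B ⇒ A)%F ->
  entails strong_lob_axiom H (phi[p := A] ⇒ phi[p := B])%F.
Proof.
elim: phi A B => [q|||C IHC D IHD|C IHC D IHD|C IHC D IHD|C IHC D IHD] A B
  dAB dBA /=; try by apply: entails_thm; apply: entails_refl.
- by case: ifP => // _; apply: entails_thm; apply: entails_refl.
- by apply: entails_and_mono; [apply: IHC | apply: IHD].
- by apply: entails_or_mono; [apply: IHC | apply: IHD].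
- by apply: entails_imp_mono; [apply: IHC | apply: IHD].
- by apply: entails_simp_mono; apply: entails_box; [apply: IHC | apply: IHD].
Qed.

Lemma entails_subst_box p phi H A B :
    entails strong_lob_axiom H (□ (A ⇒ B))%F ->
    entails strong_lob_axiom H (□ (B ⇒ A))%F ->
  entails strong_lob_axiom H (□ (phi[p := A] ⇒ phi[p := B]))%F.
Proof.
move=> dAB dBA; apply: entails_box_mono (entails_box_and _ _ _ _ dAB dBA).
by apply: entails_subst; [apply: ax_andE1 | apply: ax_andE2].
Qed.

(** The parity [b] of the occurrences outside [⇝] is carried along so that the
    induction passes through antecedents: there [b] flips and [A], [B] swap
    roles, which leaves the unboxed hypothesis unchanged. *)
Lemma entails_subst_polarity p phi b H A B :
    (forall n s, occurs p phi n s -> odd n = b \/ s = true) ->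
    entails strong_lob_axiom H (□ (A ⇒ B))%F ->
    entails strong_lob_axiom H (□ (B ⇒ A))%F ->
    entails strong_lob_axiom H (if b then B ⇒ A else A ⇒ B)%F ->
  entails strong_lob_axiom H (phi[p := A] ⇒ phi[p := B])%F.
Proof.
elim: phi b A B => [q|||C IHC D IHD|C IHC D IHD|C IHC D IHD|C IHC D IHD] b A B
  pol bAB bBA dAB /=; try by apply: entails_thm; apply: entails_refl.
- case: eqP => [q_p|_]; last by apply: entails_thm; apply: entails_refl.
  (* The variable itself is a positive unguarded occurrence, so [b] is false. *)
  rewrite q_p in pol; case: (pol _ _ (occ_var p)) => // b_even.
  by rewrite -b_even in dAB.
- by apply: entails_and_mono; [apply: (IHC b) | apply: (IHD b)] => // n s occ;
    apply: pol; [apply: occ_andl | apply: occ_andr].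
- by apply: entails_or_mono; [apply: (IHC b) | apply: (IHD b)] => // n s occ;
    apply: pol; [apply: occ_orl | apply: occ_orr].
- apply: entails_imp_mono.
  + apply: (IHC (~~ b)) => // [n s occ|]; last by case: b dAB {pol}.
    by case: (pol _ _ (occ_impl D occ)) => [<-|->];
      [left; rewrite /= negbK | right].
  + by apply: (IHD b) => // n s occ; apply: pol; apply: occ_impr.
- by apply: entails_simp_mono; apply: entails_subst_box.
Qed.

(** An assumed [A] is equivalent to [⊤], so the congruence applies. *)
Lemma entails_subst_top p phi H A :
    entails strong_lob_axiom H A ->
  entails strong_lob_axiom H (phi[p := ⊤] ⇒ phi[p := A])%F /\
  entails strong_lob_axiom H (phi[p := A] ⇒ phi[p := ⊤])%F.
Proof.
move=> dA.
have dAT : entails strong_lob_axiom H (A ⇒ ⊤)%F.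
  by do 2!apply: entails_thm; apply: ax_top.
have dTA : entails strong_lob_axiom H (⊤ ⇒ A)%F.
  exact: entails_trans dA (ax_K _ _ _).
by split; apply: entails_subst.
Qed.

Theorem theorem3p18 (p : var) (phi : formula) (hphi : semi_positive p phi) :
  iSLa (phi[p := ⊤] ⇔ phi[p := phi[p := ⊤]]) /\
  (forall alpha : formula,
     iSLa (alpha ⇔ phi[p := alpha]) -> iSLa (alpha ⇒ phi[p := ⊤])).
Proof.
split.
- set A := (phi[p := ⊤])%F.
  have dA_FA : entails strong_lob_axiom A (phi[p := A])%F.
    have [dT_A _] := entails_subst_top p phi A A (entails_refl _ _).
    exact: entails_mp dT_A (entails_refl _ _).
  have dFA_A : entails strong_lob_axiom (phi[p := A])%F A.
    apply: entails_lob; set H : formula := (_ ∧ _)%F.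
    have bTA : entails strong_lob_axiom H (□ (⊤ ⇒ A))%F.
      by apply: entails_box_mono (entails_last _ _ _); apply: ax_K.
    have dAT : entails strong_lob_axiom H (A ⇒ ⊤)%F.
      by do 2!apply: entails_thm; apply: ax_top.
    have bAT := entails_box _ _ dAT.
    apply: entails_mp (ax_andE1 _ _ _).
    apply: (@entails_subst_polarity _ _ false) => // n s occ.
    by case: (hphi _ _ occ) => [/negbTE|]; [left | right].
  by apply: rule_mp dFA_A; apply: rule_mp dA_FA; apply: ax_andI.
- move=> alpha fix_alpha.
  have dF : entails strong_lob_axiom alpha (phi[p := alpha])%F.
    exact: rule_mp (ax_andE1 _ _ _) fix_alpha.
  have [_ dF_T] := entails_subst_top p phi alpha alpha (entails_refl _ _).
  exact: entails_mp dF_T dF.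
Qed.
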